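(* The Recht--Ré inequality fails for $m=n=5$: there exist a positive integer $p$ and real symmetric positive semidefinite $p\times p$ matrices $A_1,\dots,A_5$ such that $$\frac{1}{5^5}\Bigl\lVert\sum_{1\leq j_1,\dots,j_5\leq 5} A_{j_1}A_{j_2}A_{j_3}A_{j_4}A_{j_5}\Bigr\rVert \;<\; \frac{1}{5!}\Bigl\lVert\sum_{\sigma\in\mathfrak{S}_5} A_{\sigma(1)}A_{\sigma(2)}A_{\sigma(3)}A_{\sigma(4)}A_{\sigma(5)}\Bigr\rVert .$$
   Context: $\lVert\cdot\rVert$ denotes the spectral norm (operator $2$-norm) of a matrix. $\mathfrak{S}_5$ is the symmetric group on $\{1,\dots,5\}$. The Recht--Ré conjecture asserts that for all positive integers $m\le n$ and all symmetric positive semidefinite matrices $A_1,\dots,A_n$ (of the same size), $$\frac{1}{n^m}\Bigl\lVert\sum_{1\leq j_1,\dots,j_m\leq n} A_{j_1}\cdots A_{j_m}\Bigr\rVert \geq \frac{(n-m)!}{n!}\Bigl\lVert\sum_{\substack{1\leq j_1,\dots,j_m\leq n\\ j_1,\dots,j_m\text{ distinct}}} A_{j_1}\cdots A_{j_m}\Bigr\rVert .$$ *)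

(* Defs.v *)
From mathcomp Require Import all_boot all_order all_fingroup all_algebra.
From mathcomp Require Import all_classical all_reals.

Set Implicit Arguments.
Unset Strict Implicit.
Unset Printing Implicit Defensive.

Import Order.TTheory GRing.Theory Num.Theory.

Local Open Scope classical_set_scope.
Local Open Scope ring_scope.

Definition enorm (R : realType) (p : nat) (x : 'cV[R]_p) : R :=
  Num.sqrt (\sum_i x i 0 ^+ 2).

(* The norms that MathComp-Analysis puts on matrices are entrywise maxima;
   this is the operator norm induced by the Euclidean norm.  The set is
   nonempty and bounded above, so that [sup] is a genuine supremum. *)
Definition specnorm (R : realType) (p : nat) (M : 'M[R]_p) : R :=
  sup [set enorm (M *m x) | x in [set x : 'cV[R]_p | enorm x <= 1]].

Definition psdmx (R : realType) (p : nat) (M : 'M[R]_p) : Prop :=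
  M \is symmetricmx /\ forall x : 'cV[R]_p, 0 <= (x^T *m M *m x) 0 0.

(* Main.v *)
(* Let r_1, ..., r_5 point to the vertices of a regular simplex centred at 0, let
   e be a unit vector orthogonal to all of them, and put
   A_i = c I + e r_i^T + r_i e^T, which is positive semidefinite as soon as
   |r_i| <= c.  The linear terms cancel in the sum, so that sum_i A_i = 5 c I and
   the left-hand side is c^5.  The pairing <r_i, r_j> = g is the same for all
   i <> j, hence <e, A_{s(1)} ... A_{s(5)} e> does not depend on the permutation
   s; it equals c^5 + 10 c^3 g + 5 c g^2.  With c = 9 and g = -20 (so that
   |r_i|^2 = 80 < 81) this is -68751, while 9^5 = 59049. *)
Require Import Defs.
From mathcomp Require Import all_boot all_order all_fingroup all_algebra.
From mathcomp Require Import all_classical all_reals.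
From mathcomp Require Import ring lra.

Import Order.TTheory GRing.Theory Num.Theory.

Local Open Scope ring_scope.

Section SpectralNorm.
Context {R : realType} {p : nat}.
Implicit Types (x : 'cV[R]_p) (M : 'M[R]_p).

Lemma enorm_ge0 x : 0 <= enorm x.
Proof. exact: sqrtr_ge0. Qed.

Lemma sqr_enorm x : enorm x ^+ 2 = \sum_i x i 0 ^+ 2.
Proof. by rewrite sqr_sqrtr// sumr_ge0// => i _; rewrite sqr_ge0. Qed.

Lemma enorm0 : enorm (0 : 'cV[R]_p) = 0.
Proof.
by rewrite /enorm big1 ?sqrtr0// => i _; rewrite mxE expr0n.
Qed.

Lemma enorm_delta (j : 'I_p) : enorm (delta_mx j 0 : 'cV[R]_p) = 1.
Proof.
rewrite /enorm (bigD1 j)//= big1 ?addr0 ?mxE ?eqxx ?expr1n ?sqrtr1//.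
by move=> i /negPf ne; rewrite mxE ne expr0n.
Qed.

Lemma enormZ (a : R) x : enorm (a *: x) = `|a| * enorm x.
Proof.
rewrite /enorm -sqrtr_sqr -sqrtrM ?sqr_ge0// mulr_sumr.
by congr Num.sqrt; apply: eq_bigr => i _; rewrite mxE exprMn.
Qed.

Lemma normr_le_enorm x i : `|x i 0| <= enorm x.
Proof.
rewrite -(ler_pXn2r (n := 2))// ?nnegrE ?enorm_ge0//.
rewrite real_normK ?num_real// sqr_enorm (bigD1 i)//= lerDl.
by rewrite sumr_ge0// => k _; rewrite sqr_ge0.
Qed.

Lemma enorm_le_sum x : enorm x <= \sum_i `|x i 0|.
Proof.
have S0 (P : pred 'I_p) : 0 <= \sum_(i | P i) `|x i 0| by rewrite sumr_ge0.
rewrite -(ler_pXn2r (n := 2))// ?nnegrE ?enorm_ge0// sqr_enorm.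
rewrite expr2 mulr_suml; apply: ler_sum => i _.
rewrite -real_normK ?num_real// expr2 ler_wpM2l// (bigD1 i)//= lerDl.
exact: S0.
Qed.

(** Lower bounds on [specnorm] rely on this, as [sup] has a default value on unbounded sets. *)
Lemma specnorm_has_ubound M :
  has_ubound [set enorm (M *m x) | x in [set x | enorm x <= 1]]%classic.
Proof.
exists (\sum_i \sum_j `|M i j|) => _ [x /= x1 <-].
apply: le_trans (enorm_le_sum _) _; apply: ler_sum => i _.
rewrite mxE; apply: le_trans (ler_norm_sum _ _ _) _.
apply: ler_sum => j _; rewrite normrM ler_piMr//.
exact: le_trans (normr_le_enorm _ _) x1.
Qed.

(** Obtained by testing on a unit basis vector; a single entry will bound the permutation side from
    below. *)
Lemma normr_le_specnorm M i j : `|M i j| <= specnorm M.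
Proof.
have -> : M i j = (M *m (delta_mx j 0 : 'cV_p)) i 0 by rewrite -colE mxE.
apply: le_trans (normr_le_enorm _ _) _.
apply: ub_le_sup; first exact: specnorm_has_ubound.
by exists (delta_mx j 0) => //=; rewrite enorm_delta.
Qed.

Lemma specnorm_scalar_le (a : R) : 0 <= a -> specnorm (a%:M : 'M[R]_p) <= a.
Proof.
move=> a0; apply: ge_sup.
  by exists (enorm (a%:M *m 0 : 'cV[R]_p)), 0 => //=; rewrite enorm0.
move=> _ [x /= x1 <-].
by rewrite mul_scalar_mx enormZ ger0_norm// ler_piMr.
Qed.

End SpectralNorm.

Section DotProduct.
Context {R : realType} {p : nat}.
Implicit Types (x y z : 'cV[R]_p) (a : R).

Definition dot x y : R := \sum_i x i 0 * y i 0.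

Lemma dotC x y : dot x y = dot y x.
Proof. by apply: eq_bigr => i _; rewrite mulrC. Qed.

Lemma dotDr x y z : dot x (y + z) = dot x y + dot x z.
Proof.
by rewrite -big_split; apply: eq_bigr => i _ /=; rewrite mxE mulrDr.
Qed.

Lemma dotDl x y z : dot (x + y) z = dot x z + dot y z.
Proof. by rewrite !(dotC _ z) dotDr. Qed.

Lemma dotZr x a y : dot x (a *: y) = a * dot x y.
Proof. by rewrite mulr_sumr; apply: eq_bigr => i _; rewrite mxE mulrCA. Qed.

Lemma dotZl a x y : dot (a *: x) y = a * dot x y.
Proof. by rewrite !(dotC _ y) dotZr. Qed.

Lemma dot_ge0 x : 0 <= dot x x.
Proof. by apply: sumr_ge0 => i _; rewrite -expr2 sqr_ge0. Qed.

Lemma tr_mul_cV x y : x^T *m y = (dot x y)%:M.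
Proof.
apply/matrixP => i j; rewrite !ord1 !mxE eqxx.
by apply: eq_bigr => k _; rewrite mxE.
Qed.

End DotProduct.

Section BorderedScalar.
Context {R : realType} {p : nat}.
Implicit Types (c : R) (e r x : 'cV[R]_p).

Definition bordered c e r : 'M[R]_p := c%:M + e *m r^T + r *m e^T.

Lemma bordered_mul c e r x :
  bordered c e r *m x = c *: x + dot r x *: e + dot e x *: r.
Proof.
by rewrite !mulmxDl mul_scalar_mx -!mulmxA !tr_mul_cV !mul_mx_scalar.
Qed.

(** Completing the square: with a = <e, x> and b = <r, x>, the form c |x|^2 + 2ab equals c |x - a e
    + (a/c) r|^2 + (a^2/c) (c^2 - |r|^2). *)
Lemma bordered_psd c e r :
  0 < c -> dot e e = 1 -> dot e r = 0 -> dot r r <= c ^+ 2 ->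
  psdmx (bordered c e r).
Proof.
move=> c0 ee er rc; split=> [|x].
  apply/is_hermitianmxP; rewrite expr0 scale1r map_mx_id// /bordered.
  by rewrite !linearD /= tr_scalar_mx !trmx_mul !trmxK addrAC.
rewrite -mulmxA bordered_mul tr_mul_cV mxE eqxx mulr1n !dotDr !dotZr.
rewrite (dotC x e) (dotC x r); set a := dot e x; set b := dot r x.
have := dot_ge0 (x - a *: e + (a / c) *: r).
rewrite -scaleNr !(dotDr, dotDl, dotZr, dotZl) (dotC x e) (dotC x r) (dotC r e).
rewrite -/a -/b ee er => /(mulr_ge0 (ltW c0)) sq0.
have : 0 <= a ^+ 2 / c * (c ^+ 2 - dot r r).
  by rewrite mulr_ge0 ?subr_ge0// divr_ge0 ?sqr_ge0// ltW.
move/(addr_ge0 sq0); congr (0 <= _).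
by field; rewrite gt_eqF.
Qed.

End BorderedScalar.

Section EquiangularProduct.
Context {R : realType} {p : nat} {I : eqType}.
Variables (c g : R) (e : 'cV[R]_p) (r : I -> 'cV[R]_p).
Hypotheses (ee : dot e e = 1) (er : forall i, dot e (r i) = 0).
Hypothesis rr : forall i j, i != j -> dot (r i) (r j) = g.

Let step (u : R * R) := (c * u.1 + u.2, g * u.1 + c * u.2).

(* The orthogonality of [r i] to [e] and the constancy of [dot (r i) (r j)] make
   the pair (component along [e], pairing with any unused [r i]) evolve
   autonomously. *)
Lemma bordered_prod_mul (s : seq I) :
  uniq s ->
  let x := (\prod_(i <- s) bordered c e (r i)) *m e in
  let u := iter (size s) step (1, 0) in
  dot e x = u.1 /\ forall i, i \notin s -> dot (r i) x = u.2.
Proof.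
elim: s => [_|i s IHs /= /andP[is_s us]] /=.
  by rewrite big_nil mul1mx ee; split=> // i _; rewrite dotC er.
rewrite big_cons -mulmxE -mulmxA bordered_mul.
have [IHe IHr] := IHs us; split=> [|j].
  by rewrite !dotDr !dotZr IHe ee er (IHr _ is_s); ring.
rewrite inE negb_or => /andP[ji js].
rewrite !dotDr !dotZr IHe (IHr _ js) (dotC _ e) er rr//.
by ring.
Qed.

End EquiangularProduct.

(* Coordinate 0 is reserved for the unit vector [e]. *)
Definition simplex_vec (R : realType) (k : 'I_5) : 'cV[R]_(1 + 5) :=
  col_mx 0 (\col_j (if j == k then 8 else - 2)).

(** The last five coordinates are 10 times the projection of a basis vector onto the sum-zero
    hyperplane: 64 + 4 * 4 = 80 and 2 * (-16) + 3 * 4 = -20. *)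
Lemma dot_simplex_vec (R : realType) (i j : 'I_5) :
  dot (simplex_vec R i) (simplex_vec R j) = if i == j then 80 else - 20.
Proof.
rewrite /dot big_split_ord big_ord1 /= !col_mxEu mxE mul0r add0r.
under eq_bigr do rewrite !col_mxEd !mxE.
rewrite !big_ord_recl big_ord0.
by case: i => -[|[|[|[|[|//]]]]] ?; case: j => -[|[|[|[|[|//]]]]] ?;
  rewrite /eq_op /=; lra.
Qed.

Lemma sum_simplex_vec (R : realType) : \sum_k simplex_vec R k = 0.
Proof.
apply/matrixP => i j; rewrite !ord1 summxE mxE.
case: (split_ordP i) => k ->.
  by rewrite big1// => l _; rewrite col_mxEu mxE.
under eq_bigr do rewrite col_mxEd mxE.
rewrite !big_ord_recl big_ord0.
by case: k => -[|[|[|[|[|//]]]]] ?; rewrite /eq_op /=; lra.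
Qed.

Theorem mainTheorem1 (R : realType) :
  exists (p : nat) (A : 'I_5 -> 'M[R]_p),
    [/\ (0 < p)%N,
        forall i : 'I_5, psdmx (A i) &
        (5%:R ^+ 5)^-1 *
          specnorm (\sum_(j : {ffun 'I_5 -> 'I_5}) \prod_(k < 5) A (j k))
        < (5`!%:R)^-1 *
          specnorm (\sum_(s : 'S_5) \prod_(k < 5) A (s k))].
Proof.
pose e : 'cV[R]_(1 + 5) := delta_mx 0 0.
pose A k := bordered 9 e (simplex_vec R k).
have dote x : dot e x = x 0 0.
  rewrite /dot (bigD1 0)//= big1 ?addr0 => [|i /negPf i0].
    by rewrite mxE eqxx mul1r.
  by rewrite mxE i0 mul0r.
have ee : dot e e = 1 by rewrite dote mxE.
have er k : dot e (simplex_vec R k) = 0.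
  by rewrite dote -[0](lshift0 5 0) col_mxEu mxE.
(* [step] acts as c + N with N^2 = g; [d] is the part of (c + N)^5 even in N. *)
pose d : R := 9 ^+ 5 + 10 * 9 ^+ 3 * (- 20) + 5 * 9 * (- 20) ^+ 2.
have perm_prod (s : 'S_5) : (\prod_(k < 5) A (s k)) 0 0 = d.
  have rr i j : i != j -> dot (simplex_vec R i) (simplex_vec R j) = - 20.
    by rewrite dot_simplex_vec => /negPf ->.
  have us : uniq [seq s k | k <- index_enum 'I_5].
    by rewrite map_inj_uniq ?index_enum_uniq//; exact: perm_inj.
  have size5 : size (index_enum 'I_5) = 5%N.
    by rewrite /index_enum unlock -enumT size_enum_ord.
  have [] := bordered_prod_mul 9 _ _ _ ee er rr _ us.
  rewrite big_map size_map size5 dote -colE mxE /= => -> _.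
  by rewrite /d; ring.
have sumA : \sum_k A k = 45%:M.
  rewrite /A /bordered !big_split /= -mulmx_sumr -mulmx_suml -linear_sum /=.
  rewrite sum_simplex_vec trmx0 mulmx0 mul0mx !addr0 sumr_const card_ord.
  by rewrite -raddfMn; congr (_%:M); lra.
exists (1 + 5)%N, A; split=> // [i|].
  by apply: bordered_psd => //; rewrite ?dot_simplex_vec ?eqxx; lra.
(* Distributivity turns the sum over all index maps into the fifth power of [45%:M], and 45^5 / 5^5
   = 9^5. *)
rewrite -(bigA_distr_bigA (fun=> A)) /= sumA !big_ord_recl big_ord0 mulr1.
rewrite -!mulmxE -!scalar_mxM.
apply: (@le_lt_trans _ _ (9 ^+ 5)).
  rewrite ler_pdivrMl ?exprn_gt0//; apply: le_trans (specnorm_scalar_le _ _) _.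
    lra.
  lra.
(* [d] is negative, so the comparison goes through -d = 68751. *)
apply: (@lt_le_trans _ _ `|d|); first by rewrite ltr_normr /d; lra.
rewrite ler_pdivlMl ?ltr0n ?fact_gt0//.
apply: le_trans (normr_le_specnorm _ 0 0).
(* All 5! permutations contribute the same [d], so nothing cancels in entry (0, 0). *)
rewrite summxE (eq_bigr _ (fun s _ => perm_prod s)) sumr_const card_Sn.
by rewrite normrMn mulr_natl.
Qed.
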